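(* Let $n$ be a positive integer and $m=\prod_{j=1}^t p_j^{\alpha_j}$, where $5\le p_1<p_2<\dots<p_t$ are primes and the $\alpha_j$ are positive integers. If there exists a generalized bent function $f:\mathbb{Z}_3^n\to\mathbb{Z}_m$, then $t\ge 2$ and $2p_1+p_2\le 3^n$.
   Context: A function $f:G\to\mathbb{Z}_m$ on a finite abelian group $G$ is a generalized bent function if $\left|\sum_{x\in G}\zeta_m^{f(x)}\chi(x)\right|^2=|G|$ for every character $\chi$ of $G$, where $\zeta_m$ is a primitive $m$-th root of unity. *)

(* Defs.v *)
From HB Require Import structures.
From mathcomp Require Import all_boot all_order all_algebra all_fingroup all_field all_character.

Set Implicit Arguments.
Unset Strict Implicit.
Unset Printing Implicit Defensive.

Import GRing.Theory Num.Theory.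
Local Open Scope ring_scope.

(* The characters of the finite abelian group G (homomorphisms from G to the
   multiplicative group of the complex numbers) are the linear characters of
   [set: G], where G is seen as a finGroupType through its additive law. The
   values are algebraic, so nothing is lost by working in algC.
   zeta is meant to be a primitive m-th root of unity, and 1 < m, as 'Z_m is
   the ring of integers mod m only in that case. *)
Definition generalized_bent (G : finZmodType) (m : nat) (zeta : algC)
    (f : G -> 'Z_m) : Prop :=
  forall chi : 'CF([set: G]%G), chi \is a linear_char ->
    `| \sum_(x : G) zeta ^+ f x * chi x | ^+ 2 = #|G|%:R.

(* Main.v *)
Require Import Defs.
From HB Require Import structures.
From mathcomp Require Import all_boot all_order all_algebra all_fingroup all_field all_character.
From mathcomp Require Import zify.

(** Fourier inversion turns bentness into [\sum_x zeta ^+ (f x - f (x + d)) = 0]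
    for [d != 0], a vanishing sum of [3 ^ n] roots of unity of order dividing
    [m].  A weak form of the Lam-Leung theorem says that a vanishing sum of [N]
    such roots has [N >= 2 p_1 + p_2] or [N] a sum of prime divisors of [m].  In
    the second case, [N = 3 ^ n] being odd and coprime to [m], the sum of primes
    has at least three terms and involves a prime other than [p_1], so again
    [N >= 2 p_1 + p_2].

    The weak Lam-Leung theorem goes by induction on [m], with [r] the largest
    prime divisor of [m] and [m = r k].  Sorting the roots along the [r] cosets
    of [mu_k], Galois averaging shows that all coset sums take the same value
    [v], with [v = 0] if [r] divides [k].  If [v != 0], a coset with the fewest
    roots contains [w > 0] of them, and either [w >= 3], or these [w] roots
    occur (up to rotation) in every coset and can be split off, or else some
    coset yields a relation between at most two roots on one side and other
    roots on the other, which must be long. *)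

Section VanishingSums.

Set Implicit Arguments.
Unset Strict Implicit.
Unset Printing Implicit Defensive.
Import Order.TTheory GRing.Theory Num.Theory.
Local Open Scope ring_scope.

Implicit Types (P S : seq algC) (z w rho eta : algC).

(** * Finite Fourier inversion *)

(** Orthogonality: after exchanging the sums, the geometric sum over [c] vanishes unless [i = j].
    The exponent [r - j] plays the role of [-j]. *)
Lemma dft_inversion r w (V : 'I_r -> algC) (j : 'I_r) : r.-primitive_root w ->
  \sum_(c < r) w ^+ (c * (r - j)) * (\sum_(i < r) w ^+ (i * c) * V i)
  = r%:R * V j.
Proof.
move=> w_prim; have w1 := prim_expr_order w_prim.
under eq_bigr => c _ do rewrite big_distrr /=.
rewrite exchange_big (bigD1 j) //= [X in _ + X]big1 ?addr0 => [|i ij].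
  rewrite (eq_bigr (fun=> V j)) => [|c _]; last first.
    rewrite mulrA -exprD mulnC -mulnDl subnK; last exact: ltnW.
    by rewrite exprM w1 expr1n mul1r.
  by rewrite sumr_const card_ord mulr_natl.
set u := w ^+ (i + (r - j)).
rewrite (eq_bigr (fun c : 'I_r => u ^+ c * V i)) => [|c _]; last first.
  by rewrite mulrA -exprD /u -exprM mulnDl addnC [(c * _)%N]mulnC.
rewrite -big_distrl /=.
(* The exponent [i + (r - j)] lies strictly between [0] and [2 * r], so [r] divides it only when
   [i = j]. *)
have u_neq1 : u - 1 != 0.
  rewrite subr_eq0 -(prim_order_dvd w_prim); apply: contra ij => dv_r.
  apply/eqP/val_inj => /=; have := ltn_ord i; have := ltn_ord j.
  by case/dvdnP: dv_r => -[|[|k]]; nia.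
have : (u - 1) * \sum_(c < r) u ^+ c = 0.
  by rewrite -subrX1 /u -exprM mulnC exprM w1 expr1n subrr.
by move/eqP; rewrite mulf_eq0 (negPf u_neq1) => /eqP ->; rewrite mul0r.
Qed.

(** * Cosets of the [k]-th roots of unity among the [(r * k)]-th ones *)

(** Dividing by [rho] rotates the coset back to [k]-th roots of unity, to which an induction on the
    modulus applies; sequences keep multiplicities. *)
Definition root_class (k : nat) rho S : seq algC :=
  [seq z / rho | z <- S & k.-unity_root (z / rho)].

Lemma root_class_unity k rho S : all k.-unity_root (root_class k rho S).
Proof. by apply/allP => y /mapP[z]; rewrite mem_filter => /andP[? _] ->. Qed.

Lemma mem_root_class k rho S z : rho != 0 ->
  (z / rho \in root_class k rho S) = (z \in S) && k.-unity_root (z / rho).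
Proof.
move=> rho0; have inj_rho : injective (fun z => z / rho).
  by apply: mulIf; rewrite invr_eq0.
by rewrite (mem_map inj_rho) mem_filter andbC.
Qed.

Lemma root_class_sub k rho S y : rho != 0 ->
  y \in root_class k rho S -> y * rho \in S.
Proof.
by move=> rho0 /mapP[z]; rewrite mem_filter => /andP[_ zS] ->; rewrite divfK.
Qed.

Section Cosets.

Variables (r k : nat) (rho : algC).
Hypothesis rho_prim : r.-primitive_root (rho ^+ k).

Let class i S := root_class k (rho ^+ i) S.

Lemma coset_rep_neq0 : (0 < k)%N -> rho != 0.
Proof.
move=> k0; apply/eqP => rho0; have := prim_expr_order rho_prim.
rewrite rho0 expr0n; have r0 := prim_order_gt0 rho_prim.
by rewrite eqn0Ngt k0 expr0n eqn0Ngt r0 => /eqP; rewrite eq_sym oner_eq0.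
Qed.

(** [z ^+ k] is an [r]-th root of unity, hence a power of the primitive root [rho ^+ k]; the
    exponent is the index of the coset. *)
Lemma coset_uniq z : (0 < k)%N -> (r * k).-unity_root z ->
  exists i : 'I_r, forall j : 'I_r, k.-unity_root (z / rho ^+ j) = (j == i).
Proof.
move=> k0 /unity_rootP zrk.
have [|i Di] := @prim_rootP _ _ _ rho_prim (z ^+ k); first by rewrite -exprM mulnC.
exists i => j; have rho0 := coset_rep_neq0 k0.
have rj0 : rho ^+ j ^+ k != 0 by rewrite !expf_neq0.
rewrite unity_rootE expr_div_n Di -(inj_eq (mulIf rj0)) divfK // mul1r.
rewrite -[X in _ == X]exprM mulnC exprM (eq_prim_root_expr rho_prim).
by rewrite !modn_small // eq_sym.
Qed.

Lemma sum_size_classes S : (0 < k)%N -> all (r * k).-unity_root S ->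
  (\sum_(i < r) size (class i S))%N = size S.
Proof.
move=> k0; elim: S => [|z S IH] /=; first by rewrite big1.
case/andP=> /(coset_uniq k0)[i Hi] /IH <-.
rewrite [in RHS](bigD1 i) //= (bigD1 i) //= /class /root_class /= Hi eqxx /=.
rewrite addSn; congr (_ + _).+1.
by apply: eq_bigr => j /negPf ji; rewrite Hi ji.
Qed.

Lemma sum_classes S : (0 < k)%N -> all (r * k).-unity_root S ->
  \sum_(i < r) rho ^+ i * \sum_(z <- class i S) z = \sum_(z <- S) z.
Proof.
move=> k0; have rho0 := coset_rep_neq0 k0.
elim: S => [|z S IH] /=.
  by move=> _; rewrite big_nil big1 // => i _; rewrite mulr0.
case/andP=> /(coset_uniq k0)[i Hi] /IH; rewrite big_cons => <-.
rewrite [in RHS](bigD1 i) //= (bigD1 i) //= /class /root_class /= Hi eqxx /=.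
rewrite big_cons mulrDr mulrCA divff ?expf_neq0 // mulr1 -addrA.
by do 2 congr (_ + _); apply: eq_bigr => j /negPf ji; rewrite Hi ji.
Qed.

(* The class sums lie in Q(mu_k), hence are fixed by the automorphisms with
   exponent 1 mod k. *)
Lemma sum_classes_galois P S e : (0 < k)%N ->
  all (r * k).-unity_root P -> all (r * k).-unity_root S ->
  rho ^+ (r * k) = 1 ->
  \sum_(z <- P) z = \sum_(z <- S) z ->
  e = 1 %[mod k] -> coprime e (r * k) ->
  \sum_(i < r) rho ^+ (i * e) *
     (\sum_(z <- class i P) z - \sum_(z <- class i S) z) = 0.
Proof.
move=> k0 uP uS rho_rk eqPS e1 co_e.
have [u Hu] := Qn_aut_exists co_e.
have fixu (T : seq algC) i : u (\sum_(z <- class i T) z) = \sum_(z <- class i T) z.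
  rewrite rmorph_sum; apply: eq_big_seq => z.
  move/(allP (root_class_unity _ _ _))/unity_rootP => zk.
  rewrite Hu; last by rewrite mulnC exprM zk expr1n.
  by rewrite -(expr_mod e zk) e1 (expr_mod 1 zk) expr1.
have := congr1 u eqPS; rewrite -(sum_classes k0 uP) -(sum_classes k0 uS).
rewrite !rmorph_sum => /eqP; rewrite -subr_eq0 -sumrB => /eqP sum0; rewrite -[RHS]sum0.
apply: eq_bigr => i _; rewrite !rmorphM !fixu -mulrBr; congr (_ * _).
by rewrite Hu -?exprM // mulnC exprM rho_rk expr1n.
Qed.

End Cosets.

(* [rho] enumerates representatives of the cosets of [mu_k] in [mu_(r k)]. *)
Variant class_spec r k (rho : nat -> algC) : Prop := ClassSpec of
  (forall i, rho i != 0) &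
  (forall z, (r * k).-unity_root z ->
    exists i : 'I_r, forall j : 'I_r, k.-unity_root (z / rho j) = (j == i)) &
  (forall S, all (r * k).-unity_root S ->
    (\sum_(i < r) size (root_class k (rho i) S))%N = size S) &
  (forall P S, all (r * k).-unity_root P -> all (r * k).-unity_root S ->
    \sum_(z <- P) z = \sum_(z <- S) z ->
    exists2 v : algC, forall i : 'I_r, \sum_(z <- root_class k (rho i) S) z
                     = \sum_(z <- root_class k (rho i) P) z + v
             & (r %| k)%N -> v = 0).

(** If [r] divides [k], the Galois relations kill every Fourier coefficient of [rho ^+ i * V i], so
    [V = 0]. Otherwise they kill all coefficients of [V] but the one at [0], so [V] is constant. *)
Lemma class_decomposition r k : prime r -> (0 < k)%N ->
  exists rho : nat -> algC, class_spec r k rho.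
Proof.
move=> r_pr k0; have r0 := prime_gt0 r_pr.
have rR0 : r%:R != 0 :> algC by rewrite pnatr_eq0 -lt0n.
(* [V] stands for the differences of the class sums of [S] and [P], and [e] for the exponent of an
   automorphism fixing the [k]-th roots of unity. *)
suff [rho [rho_prim rho_rk Hv]] : exists rho : algC,
  [/\ r.-primitive_root (rho ^+ k), rho ^+ (r * k) = 1 & forall V : 'I_r -> algC,
     (forall e, e = 1 %[mod k] -> coprime e (r * k) ->
        \sum_(i < r) rho ^+ (i * e) * V i = 0) ->
     exists2 v : algC, forall i, V i = v & (r %| k)%N -> v = 0].
  exists (fun i => rho ^+ i); have rho0 := coset_rep_neq0 rho_prim k0.
  split=> [i|z|S|P S uP uS eqPS]; first exact: expf_neq0.
  - exact: coset_uniq.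
  - exact: sum_size_classes.
  have := Hv (fun i => \sum_(z <- root_class k (rho ^+ i) S) z -
                       \sum_(z <- root_class k (rho ^+ i) P) z).
  case=> [e e1 co_e|v Dv v0].
    exact: (@sum_classes_galois r k rho).
  by exists v => // i; rewrite -(Dv i) addrC subrK.
have [r_k|r_k] := boolP (r %| k)%N.
  have [rho rho_prim] : {z : algC | (r * k).-primitive_root z}.
    by apply: C_prim_root_exists; rewrite muln_gt0 r0.
  have om_prim : r.-primitive_root (rho ^+ k).
    by have := dvdn_prim_root rho_prim (dvdn_mulr k (dvdnn r)); rewrite mulKn.
  exists rho; split=> // [|V HV]; first exact: prim_expr_order.
  exists 0 => // j; apply: (mulfI rR0); rewrite mulr0.
  have rho0 := coset_rep_neq0 om_prim k0.
  apply: (@mulfI _ (rho ^+ j)); first by rewrite expf_neq0.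
  rewrite mulr0 mulrCA -(dft_inversion (fun i => rho ^+ i * V i) j om_prim).
  rewrite big1 // => c _; apply/eqP; rewrite mulf_eq0; apply/orP; right.
  (* Raising [rho ^+ i] to the power [1 + c * k] multiplies it by [(rho ^+ k) ^+ (i * c)]. This
     exponent is prime to [r * k] because [r] divides [k]. *)
  rewrite -[X in _ == X](HV (1 + c * k)%N); last 2 first.
  - by rewrite addnC modnMDl.
  - rewrite coprimeMr; apply/andP; split; last first.
      by rewrite /coprime -gcdn_modl addnC modnMDl gcdn_modl gcd1n.
    case/dvdnP: r_k => q ->; rewrite mulnA.
    by rewrite /coprime -gcdn_modl addnC modnMDl gcdn_modl gcd1n.
  apply/eqP/eq_bigr => i _; rewrite mulrA -exprM -exprD mulnDr muln1.
  by congr (rho ^+ _ * _); lia.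
have co_rk : coprime r k by rewrite prime_coprime.
have [rho rho_prim] := C_prim_root_exists r0.
exists rho; split=> [||V HV].
- by rewrite prim_root_exp_coprime // coprime_sym.
- by rewrite exprM (prim_expr_order rho_prim) expr1n.
(* The mean of [V] is its coefficient at [c = 0], up to the factor [r]. *)
exists ((\sum_(i < r) V i) / r%:R) => //.
move=> j; apply: (mulfI rR0); rewrite mulrCA divff // mulr1.
rewrite -(dft_inversion V j rho_prim) (bigD1 (Ordinal r0)) //= mul0n expr0 mul1r.
rewrite [X in _ + X]big1 ?addr0 => [|c c0]; last first.
  apply/eqP; rewrite mulf_eq0; apply/orP; right; apply/eqP.
  (* An exponent that is [c] mod [r] and [1] mod [k] is prime to [r * k], as [c != 0]. *)
  rewrite -[RHS](HV (chinese r k c 1)) ?chinese_modr //.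
    apply: eq_bigr => i _; congr (_ * _); apply/eqP.
    rewrite (eq_prim_root_expr rho_prim); apply/eqP.
    by rewrite -modnMmr -[in RHS]modnMmr chinese_modl.
  rewrite coprimeMr; apply/andP; split.
    rewrite /coprime -gcdn_modl chinese_modl // gcdn_modl -/(coprime _ _).
    rewrite coprime_sym prime_coprime // gtnNdvd // lt0n.
    by apply: contra c0 => c0; apply/eqP/val_inj/eqP.
  by rewrite /coprime -gcdn_modl chinese_modr // gcdn_modl gcd1n.
by apply: eq_bigr => i _; rewrite muln0 expr0 mul1r.
Qed.

(** * Multisets of roots and counting over classes *)

Lemma unity1_nseq S : all 1.-unity_root S -> S = nseq (size S) 1.
Proof.
move=> uS; apply/all_pred1P; apply: sub_all uS => z.
by rewrite unity_rootE expr1.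
Qed.

Lemma sum_unity1 S : all 1.-unity_root S -> \sum_(z <- S) z = (size S)%:R.
Proof. by move/unity1_nseq=> {1}->; rewrite big_nseq iter_addr_0. Qed.

Lemma common_part (T : eqType) (P S : seq T) : exists C P' S' : seq T,
  [/\ perm_eq P (C ++ P'), perm_eq S (C ++ S')
    & forall x, x \in P' -> x \notin S'].
Proof.
elim: P S => [|x P IH] S; first by exists [::], [::], S.
have [xS|xS] := boolP (x \in S).
  have [C [P' [S' [pP pS dis]]]] := IH (rem x S).
  exists (x :: C), P', S'; split=> //=; first by rewrite perm_cons.
  by rewrite (permPl (perm_to_rem xS)) perm_cons.
have [C [P' [S' [pP pS dis]]]] := IH S.
exists C, (x :: P'), S'; split=> // [|z].
  by rewrite perm_sym -(cat1s x P') perm_catCA perm_cons perm_sym.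
rewrite inE => /predU1P[->|/dis //].
by apply: contra xS => xS'; rewrite (perm_mem pS) mem_cat xS' orbT.
Qed.

Lemma leq_sum_others r (F : 'I_r -> nat) i c :
  (forall j, j != i -> c <= F j)%N -> (F i + r.-1 * c <= \sum_(j < r) F j)%N.
Proof.
move=> leF; rewrite (bigD1 i) //= leq_add2l.
apply: leq_trans (leq_sum _ (fun j => leF j)).
by rewrite sum_nat_const cardC1 card_ord.
Qed.

Lemma leq_sum_term r (F : 'I_r -> nat) i : (F i <= \sum_(j < r) F j)%N.
Proof. by rewrite (bigD1 i) //= leq_addr. Qed.

Lemma leq_sum_all r (F : 'I_r -> nat) c :
  (forall j, c <= F j)%N -> (r * c <= \sum_(j < r) F j)%N.
Proof.
move=> leF; apply: leq_trans (leq_sum _ (fun j _ => leF j)).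
by rewrite sum_nat_const card_ord.
Qed.

Lemma prime_gt2_odd q : prime q -> (2 < q)%N -> odd q.
Proof. by move=> /even_prime[->|]. Qed.

Lemma prime_gap q r :
  prime q -> prime r -> (2 < q)%N -> (q < r)%N -> (q + 2 <= r)%N.
Proof.
move=> q_pr r_pr q2 qr.
have := prime_gt2_odd q_pr q2; have := prime_gt2_odd r_pr (ltn_trans q2 qr).
by clear -qr; lia.
Qed.

(* [a] and [b] stand for [p_1] and [p_2]; when [t = 1], [b] is arbitrary, which
   makes the bound [2 a + b <= 3 ^ n] contradictory. *)
Section Bounds.

Variables a b : nat.
Hypotheses (a_ge5 : (5 <= a)%N) (b_gea : (a + 2 <= b)%N).

(** * Moduli with restricted prime divisors *)

Definition admissible m :=
  (0 < m)%N && all (fun q => (q == a) || (b <= q)%N) (primes m).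

Lemma admissible_prime m q :
  admissible m -> prime q -> (q %| m)%N -> q = a \/ (b <= q)%N.
Proof.
case/andP=> m0 /allP adm q_pr q_m.
by have /adm/predU1P : q \in primes m by rewrite mem_primes q_pr m0.
Qed.

Lemma admissible_dvd k m : (k %| m)%N -> admissible m -> admissible k.
Proof.
move=> k_m adm; have m0 : (0 < m)%N by case/andP: adm.
have k0 := dvdn_gt0 m0 k_m; rewrite /admissible k0.
apply/allP => q; rewrite mem_primes k0 => /and3P[q_pr _ q_k].
by apply/predU1P; apply: admissible_prime (dvdn_trans q_k k_m).
Qed.

Variant largest_prime_spec m : Prop := LargestPrime r k of
  m = (r * k)%N & prime r & (k < m)%N & admissible k & r = a \/ (b <= r)%N &
  forall q, prime q -> (q %| k)%N -> (q <= r)%N.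

Lemma largest_primeP m : admissible m -> m != 1 -> largest_prime_spec m.
Proof.
move=> adm m1; have m0 : (0 < m)%N by case/andP: adm.
have m_gt1 : (1 < m)%N by lia.
have r_pr := max_pdiv_prime m_gt1; have r_m := max_pdiv_dvd m.
exists (max_pdiv m) (m %/ max_pdiv m)%N => //.
- by rewrite mulnC divnK.
- by rewrite ltn_Pdiv ?prime_gt1.
- exact: admissible_dvd (dvdn_div r_m) adm.
- exact: admissible_prime r_m.
move=> q q_pr q_k; apply: max_pdiv_max; rewrite mem_primes q_pr m0.
by apply: dvdn_trans q_k (dvdn_div r_m).
Qed.

(** [r < b] leaves only [r = a]; a prime divisor of [k] is then at most [a], hence equal to [a],
    although [r] does not divide [k]. *)
Lemma smallest_prime_cofactor r k : admissible k -> (r < b)%N ->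
  r = a \/ (b <= r)%N -> ~~ (r %| k)%N ->
  (forall q, prime q -> (q %| k)%N -> (q <= r)%N) -> k = 1%N.
Proof.
move=> adm r_b [Dr|]; last by lia.
move=> r_k max_r; apply/eqP; apply: contraT => k1.
have k0 : (0 < k)%N by case/andP: adm.
have q_pr : prime (pdiv k) by apply: pdiv_prime; lia.
have q_k := pdiv_dvd k; have := max_r _ q_pr q_k.
case: (admissible_prime adm q_pr q_k) => [Dq|]; last by lia.
by rewrite Dr -Dq q_k in r_k.
Qed.

(** * Relations with at most two roots on one side *)

(** Induction on [m]: if [v = 0], some class is itself a nonempty disjoint relation over the smaller
    modulus [k]; if [v != 0], either every coset is occupied or [k = 1]. *)
Lemma disjoint_relation_size m P S : admissible m ->
  all m.-unity_root P -> all m.-unity_root S ->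
  \sum_(z <- P) z = \sum_(z <- S) z ->
  (forall z, z \in P -> z \notin S) ->
  (size P <= 2)%N -> (0 < size P + size S)%N -> (a <= size S)%N.
Proof.
elim/ltn_ind: m P S => m IH P S adm uP uS eqPS disj P2 PS0.
have [m1|m_neq1] := eqVneq m 1%N.
  subst m; have /eqP := eqPS; rewrite !sum_unity1 // eqr_nat => /eqP eq_sz.
  have [n Dn] : exists n, size S = n.+1 by exists (size S).-1; lia.
  have := disj 1; rewrite (unity1_nseq uP) (unity1_nseq uS) eq_sz Dn inE eqxx.
  by move/(_ isT).
have [r k Dm r_pr k_m admk rab max_r] := largest_primeP adm m_neq1.
have k0 : (0 < k)%N by case/andP: admk.
rewrite Dm in uP uS.
have [rho [rho0 _ szc Hv]] := class_decomposition r_pr k0.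
have [v Dv v0] := Hv _ _ uP uS eqPS.
have szP := szc _ uP; have szS := szc _ uS.
have [v_eq0|v_neq0] := eqVneq v 0.
  have [i PSi|PS_all0] := pickP (fun i : 'I_r =>
      0 < size (root_class k (rho i) P) + size (root_class k (rho i) S))%N.
    have leSi : (size (root_class k (rho i) S) <= size S)%N.
      rewrite -szS.
      exact: (leq_sum_term (fun i : 'I_r => size (root_class k (rho i) S))).
    have lePi : (size (root_class k (rho i) P) <= size P)%N.
      rewrite -szP.
      exact: (leq_sum_term (fun i : 'I_r => size (root_class k (rho i) P))).
    apply: leq_trans leSi.
    apply: IH k_m (root_class k (rho i) P) _ admk _ _ _ _ _ PSi => //.
    - exact: root_class_unity.
    - exact: root_class_unity.
    - by rewrite Dv v_eq0 addr0.
    - move=> z /(root_class_sub (rho0 i)) /disj; apply: contra.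
      exact: root_class_sub.
    - exact: leq_trans P2.
  move: PS0; rewrite -szP -szS -big_split /= big1 // => i _.
  by have := PS_all0 i; lia.
have r_k : ~~ (r %| k)%N by apply: contra v_neq0 => /v0 ->.
have [b_r|r_b] := leqP b r.
  (* A coset missing both [P] and [S] would give [v = 0]. The bound then follows from
     [a + 2 <= b <= r] and [size P <= 2]. *)
  suff : (r * 1 <= size P + size S)%N by lia.
  rewrite -szP -szS -big_split /=; apply: leq_sum_all => i.
  rewrite lt0n addn_eq0; apply: contra v_neq0 => /andP[/nilP Pi /nilP Si].
  by have := Dv i; rewrite Pi Si !big_nil add0r => <-.
have k1 := smallest_prime_cofactor admk r_b rab r_k max_r.
have Dr : r = a by case: rab => //; lia.
(* Over [Q] the class sums are differences of two sizes; as [size P < r],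
   small [S] would leave both an empty class of [P] and one of [S]. *)
rewrite leqNgt; apply: contra v_neq0 => S_lt.
have emptyc (T : seq algC) : all (r * k).-unity_root T -> (size T < r)%N ->
    exists i : 'I_r, root_class k (rho i) T = [::].
  move=> uT T_lt.
  have [i /nilP Ti|Tn] := pickP (fun i : 'I_r => nilp (root_class k (rho i) T)).
    by exists i.
  suff : (r * 1 <= size T)%N by lia.
  rewrite -(szc _ uT); apply: leq_sum_all => i.
  by rewrite lt0n; apply/negbT; apply: Tn.
have [|i Pi] := emptyc _ uP; first lia.
have [|j Sj] := emptyc _ uS; first lia.
have uc (T : seq algC) l : \sum_(z <- root_class k (rho l) T) z
    = (size (root_class k (rho l) T))%:R.
  by apply: sum_unity1; rewrite -{1}k1 root_class_unity.
have := Dv i; rewrite Pi big_nil add0r uc => v_ge.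
have /eqP := Dv j; rewrite Sj big_nil uc -v_ge eq_sym -natrD pnatr_eq0.
by rewrite addn_eq0 => /andP[_ /eqP ->].
Qed.

(** The class of [eta] sums to [eta' + v] and all others to [v], so either the relation descends to
    [k] or every other class is nonempty. The prime [q] serves later to make the largest prime
    exceed [b]. *)
Lemma root_as_other_roots m eta S : admissible m -> m.-unity_root eta ->
  all m.-unity_root S -> \sum_(z <- S) z = eta -> eta \notin S ->
  (2 * a - 1 <= size S)%N /\ exists q, [/\ prime q, (q %| m)%N & (b <= q)%N].
Proof.
elim/ltn_ind: m eta S => m IH eta S adm u_eta uS sumS eta_S.
have [m1|m_neq1] := eqVneq m 1%N.
  subst m; move: u_eta eta_S; rewrite unity_rootE expr1 => /eqP eta1.
  move: sumS; rewrite (sum_unity1 uS) (unity1_nseq uS) eta1 size_nseq.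
  case: (size S) => [/eqP|n _]; first by rewrite eq_sym oner_eq0.
  by rewrite inE eqxx.
have [r k Dm r_pr k_m admk rab max_r] := largest_primeP adm m_neq1.
have k0 : (0 < k)%N by case/andP: admk.
have r1 := prime_gt1 r_pr.
rewrite Dm in uS u_eta.
have [rho [rho0 cosets szc Hv]] := class_decomposition r_pr k0.
have [||v Dv v0] := Hv [:: eta] S _ uS; first by rewrite /= u_eta.
  by rewrite big_seq1.
pose T i : seq algC := root_class k (rho i) S.
have [i Hi] := cosets _ u_eta.
have szS := szc _ uS.
have leTS (j : 'I_r) : (size (T j) <= size S)%N.
  by rewrite -szS; apply: (leq_sum_term (fun i : 'I_r => size (T i))).
pose eta' := eta / rho i.
have u_eta' : k.-unity_root eta' by rewrite Hi eqxx.
have sumTi : \sum_(z <- T i) z = eta' + v.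
  by rewrite /T Dv /root_class /= Hi eqxx big_seq1.
have sumTj (j : 'I_r) : j != i -> \sum_(z <- T j) z = v.
  by move=> /negPf ji; rewrite /T Dv /root_class /= Hi ji big_nil add0r.
have eta'T : eta' \notin T i by rewrite mem_root_class // (negPf eta_S).
have uT j : all k.-unity_root (T j) := root_class_unity _ _ _.
have lift_q : (exists q, [/\ prime q, (q %| k)%N & (b <= q)%N]) ->
    exists q, [/\ prime q, (q %| m)%N & (b <= q)%N].
  by case=> q [? q_k ?]; exists q; split; rewrite // Dm dvdn_mull.
have [v_eq0|v_neq0] := eqVneq v 0.
  rewrite v_eq0 addr0 in sumTi.
  have [leT /lift_q Hq] := IH k k_m eta' (T i) admk u_eta' (uT i) sumTi eta'T.
  by split=> //; apply: leq_trans leT (leTS i).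
have r_k : ~~ (r %| k)%N by apply: contra v_neq0 => /v0 ->.
have [b_r|r_b] := leqP b r; last first.
  (* Here [k = 1]: [T i] avoids [1] and is empty, so [v = -1], whereas any other class shows that
     [v] is a size. *)
  have k1 := smallest_prime_cofactor admk r_b rab r_k max_r.
  rewrite k1 in uT u_eta'.
  have eta1 : eta' = 1 by move: u_eta'; rewrite unity_rootE expr1 => /eqP.
  have Ti : size (T i) = 0%N.
    apply/eqP; move: eta'T; rewrite (unity1_nseq (uT i)) eta1 size_nseq.
    by case: (size (T i)) => // n; rewrite inE eqxx.
  have [j ji] : exists j : 'I_r, j != i.
    have [i0|i0] := eqVneq (i : nat) 0%N; [exists (Ordinal r1)|exists (Ordinal (ltnW r1))].
      by apply/eqP => /(congr1 val) /=; rewrite i0.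
    by apply/eqP => /(congr1 val) /= /esym/eqP; rewrite (negPf i0).
  move: sumTi; rewrite (sum_unity1 (uT i)) Ti -(sumTj j ji) (sum_unity1 (uT j)) eta1.
  by move/eqP; rewrite -[1]/(1%:R) -natrD eqr_nat.
split; last by exists r; split; rewrite // Dm dvdn_mulr.
have leS c : (forall j : 'I_r, j != i -> c <= size (T j))%N ->
    (size (T i) + r.-1 * c <= size S)%N.
  by rewrite -szS; apply: (leq_sum_others (F := fun j : 'I_r => size (T j))).
have Tj0 (j : 'I_r) : j != i -> (0 < size (T j))%N.
  move=> ji; rewrite lt0n; apply: contra v_neq0 => /nilP Tj.
  by rewrite -(sumTj j ji) Tj big_nil.
(* A singleton class forces [v] to be a root [xi]. If [xi] is in [T i], removing it reduces to the
   induction hypothesis; otherwise [T i] has the sum of two roots outside it, and so at least [a]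
   terms. Without singletons, [2 * (r - 1)] roots suffice. *)
have [j /andP[ji Tj]|Tj2] := pickP (fun j : 'I_r => (j != i) && (size (T j) < 2)%N).
  have {Tj} [xi Tj] : exists xi, T j = [:: xi].
    by case: (T j) Tj (Tj0 j ji) => [|xi []] // *; exists xi.
  have Dxi : v = xi by rewrite -(sumTj j ji) Tj big_seq1.
  have [xiT|xiT] := boolP (xi \in T i).
    have p_rem := perm_to_rem xiT.
    have sum_rem : \sum_(z <- rem xi (T i)) z = eta'.
      move: sumTi; rewrite (perm_big _ p_rem) big_cons /= Dxi addrC.
      exact: addIr.
    have [||leT _] := IH k k_m eta' (rem xi (T i)) admk u_eta' _ sum_rem.
    - by apply/allP => z /mem_rem /(allP (uT i)).
    - by apply: contra eta'T; apply: mem_rem.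
    apply: leq_trans leT (leq_trans _ (leTS i)).
    by rewrite (perm_size p_rem) /= leqnSn.
  have aT : (a <= size (T i))%N.
    apply: (@disjoint_relation_size k [:: eta'; xi]) => //=.
    - rewrite u_eta' andbT /=; apply: (allP (uT j)); rewrite Tj; exact: mem_head.
    - by rewrite sumTi Dxi big_cons big_seq1.
    by move=> z; rewrite !inE => /orP[] /eqP ->.
  by have := leS 1%N Tj0; clear -a_ge5 b_gea b_r aT; lia.
suff leT2 : forall j : 'I_r, j != i -> (2 <= size (T j))%N.
  by have := leS 2%N leT2; clear -a_ge5 b_gea b_r; lia.
by move=> j ji; have := Tj2 j; rewrite ji /= ltnNge => /negbFE.
Qed.

(** * The weak Lam-Leung theorem *)

Definition prime_sum m N :=
  exists2 L, all (mem (primes m)) L & sumn L = N.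

Lemma prime_sumD m N1 N2 :
  prime_sum m N1 -> prime_sum m N2 -> prime_sum m (N1 + N2).
Proof.
case=> L1 mL1 <- [L2 mL2 <-]; exists (L1 ++ L2); last exact: sumn_cat.
by rewrite all_cat mL1.
Qed.

Lemma prime_sum_dvd k m N :
  (0 < m)%N -> (k %| m)%N -> prime_sum k N -> prime_sum m N.
Proof.
move=> m0 k_m [L mL <-]; exists L => //; apply: sub_all mL => q /=.
rewrite !mem_primes => /and3P[-> _ q_k]; rewrite m0.
exact: dvdn_trans k_m.
Qed.

Lemma vanishing_sum_size m S : admissible m -> all m.-unity_root S ->
  \sum_(z <- S) z = 0 -> (2 * a + b <= size S)%N \/ prime_sum m (size S).
Proof.
elim/ltn_ind: m S => m IH S adm uS sumS.
have [m1|m_neq1] := eqVneq m 1%N.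
  subst m; right; exists [::] => //.
  by move/eqP: sumS; rewrite sum_unity1 // pnatr_eq0 => /eqP.
have [r k Dm r_pr k_m admk rab max_r] := largest_primeP adm m_neq1.
have k0 : (0 < k)%N by case/andP: admk.
have m0 : (0 < m)%N by case/andP: adm.
have r0 := prime_gt0 r_pr.
have k_dv : (k %| m)%N by rewrite Dm dvdn_mull.
rewrite Dm in uS.
have [rho [rho0 cosets szc Hv]] := class_decomposition r_pr k0.
have [|v Dv v0] := Hv [::] S isT uS; first by rewrite big_nil.
pose T i : seq algC := root_class k (rho i) S.
have sumT (i : 'I_r) : \sum_(z <- T i) z = v by rewrite /T Dv big_nil add0r.
have uT j : all k.-unity_root (T j) := root_class_unity _ _ _.
have szS : (\sum_(i < r) size (T i))%N = size S := szc _ uS.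
have leTS (j : 'I_r) : (size (T j) <= size S)%N.
  by rewrite -szS; apply: (leq_sum_term (fun i : 'I_r => size (T i))).
have [|S_lt] := leqP (2 * a + b) (size S); [by left | right].
(* A part [P] of sum [v] common to all classes accounts for [size P] copies of [r]; what remains of
   each class is a vanishing sum over [k], too short for the first alternative of the induction
   hypothesis. *)
have common P : \sum_(z <- P) z = v ->
    (forall i : 'I_r, exists S', perm_eq (T i) (P ++ S')) -> prime_sum m (size S).
  move=> sumP Hperm.
  have -> : size S = (r * size P + \sum_(i < r) (size (T i) - size P))%N.
    have -> : (r * size P = \sum_(i < r) size P)%N by rewrite sum_nat_const card_ord.
    rewrite -szS -big_split /=.
    apply: eq_bigr => i _; have [S' pS'] := Hperm i.
    by rewrite subnKC // (perm_size pS') size_cat leq_addr.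
  apply: prime_sumD.
    exists (nseq (size P) r); last by rewrite sumn_nseq.
    by rewrite all_nseq /= mem_primes r_pr m0 Dm dvdn_mulr ?orbT.
  apply: (big_ind (prime_sum m)) => [|N1 N2|i _]; first by exists [::].
    exact: prime_sumD.
  have [S' pS'] := Hperm i; apply: prime_sum_dvd m0 k_dv _.
  have szS' : size (T i) = (size P + size S')%N by rewrite (perm_size pS') size_cat.
  have -> : (size (T i) - size P)%N = size S' by lia.
  have [|||//] := IH k k_m S' admk.
  - apply/allP => z zS'; apply: (allP (uT i)).
    by rewrite (perm_mem pS') mem_cat zS' orbT.
  - apply: (@addrI _ v); rewrite addr0 -{1}sumP -big_cat -(sumT i).
    by apply: perm_big; rewrite perm_sym.
  by have := leTS i; lia.
have [v_eq0|v_neq0] := eqVneq v 0.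
  by apply: (common [::]) => [|i]; [rewrite big_nil | exists (T i)].
have r_k : ~~ (r %| k)%N by apply: contra v_neq0 => /v0 ->.
have [b_r|r_b] := leqP b r; last first.
  have k1 := smallest_prime_cofactor admk r_b rab r_k max_r.
  (* With [k = 1] all rotated roots equal [1], so equal sums make the classes identical. *)
  rewrite k1 in uT; pose i0 := Ordinal r0.
  apply: (common (T i0)) => [|i]; first exact: sumT.
  exists [::]; rewrite cats0 (unity1_nseq (uT i)) (unity1_nseq (uT i0)).
  suff -> : size (T i) = size (T i0) by [].
  apply/eqP; rewrite -(eqr_nat algC).
  by rewrite -!sum_unity1 // (sumT i) (sumT i0).
case: (@arg_minnP _ (Ordinal r0) xpredT (fun i : 'I_r => size (T i)) isT) => i0 _ min_i0.
have w0 : (0 < size (T i0))%N.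
  rewrite lt0n; apply: contra v_neq0 => /nilP Ti0.
  by rewrite -(sumT i0) Ti0 big_nil.
have w3 : (size (T i0) < 3)%N.
  rewrite ltnNge; apply: contraL S_lt => w3; rewrite -leqNgt -szS.
  (* [3 * r >= 3 * b >= 2 * a + b]. *)
  suff : (r * 3 <= \sum_(i < r) size (T i))%N by lia.
  by apply: leq_sum_all => i; apply: leq_trans w3 (min_i0 i isT).
apply: (common (T i0)) => [|i]; first exact: sumT.
have [C [P' [S' [pP pS disj]]]] : exists C P' S' : seq algC,
    [/\ perm_eq (T i0) (C ++ P'), perm_eq (T i) (C ++ S')
      & forall z, z \in P' -> z \notin S'] := common_part (T i0) (T i).
have szP : size (T i0) = (size C + size P')%N by rewrite (perm_size pP) size_cat.
have szSi : size (T i) = (size C + size S')%N by rewrite (perm_size pS) size_cat.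
(* If [P'] is empty, the smallest class is contained in [T i], as wanted; otherwise the relation
   between [P'] and [S'] makes [T i] too long. *)
have [/size0nil P'0|P'_gt0] := posnP (size P').
  exists S'; rewrite (permPl pS) perm_cat2r perm_sym (permPl pP) P'0.
  by rewrite cats0.
have sumPS : \sum_(z <- P') z = \sum_(z <- S') z.
  apply: (@addrI _ (\sum_(z <- C) z)); rewrite -!big_cat /=.
  by rewrite -(perm_big _ pP) -(perm_big _ pS) sumT sumT.
have uP' : all k.-unity_root P'.
  apply/allP => z zP'; apply: (allP (uT i0)).
  by rewrite (perm_mem pP) mem_cat zP' orbT.
have uS' : all k.-unity_root S'.
  apply/allP => z zS'; apply: (allP (uT i)).
  by rewrite (perm_mem pS) mem_cat zS' orbT.
have leS : (size (T i) + r.-1 * size (T i0) <= size S)%N.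
  rewrite -szS; apply: (leq_sum_others (F := fun j : 'I_r => size (T j))).
  by move=> j _; apply: min_i0.
have [w1|w2] : size (T i0) = 1%N \/ size (T i0) = 2%N.
  by clear -w0 w3; lia.
  have [eta DP'] : exists eta, P' = [:: eta].
    by case: P' szP P'_gt0 {pP disj sumPS uP'} => [|eta [|x P']] //=; [exists eta | clear -w1; lia].
  move: sumPS uP'; rewrite DP' big_seq1 /= andbT => sumS' u_eta.
  have [|leS' [q [q_pr q_k b_q]]] :=
    root_as_other_roots admk u_eta uS' (esym sumS').
    by apply: disj; rewrite DP' mem_head.
  (* As [r] does not divide [k], [q < r], and parity gives [r >= b + 2]; hence [size S >= (2 * a -
     1) + (r - 1) >= 2 * a + b]. *)
  have q_r := max_r q q_pr q_k.
  have q_neq : q <> r by move=> Dq; rewrite -Dq q_k in r_k.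
  have q_lt_r : (q < r)%N by rewrite ltn_neqAle q_r andbT; apply/eqP.
  have q_gt2 : (2 < q)%N by apply: leq_trans b_q; clear -a_ge5 b_gea; lia.
  have q2_r := prime_gap q_pr r_pr q_gt2 q_lt_r.
  move: leS S_lt; rewrite w1 szSi.
  by clear -a_ge5 b_gea leS' b_q q2_r; lia.
(* Two roots in each class and at least [a] in [T i] give
   [size S >= a + 2 * (b - 1) >= 2 * a + b]. *)
have P'_le2 : (size P' <= 2)%N by clear -szP w2; lia.
have := disjoint_relation_size admk uP' uS' sumPS disj P'_le2.
rewrite addn_gt0 P'_gt0 => /(_ isT) aS'.
move: leS S_lt; rewrite w2 szSi.
by clear -b_gea aS' b_r; lia.
Qed.

Lemma vanishing_sum_size3 m S n : admissible m -> all m.-unity_root S ->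
  \sum_(z <- S) z = 0 -> size S = (3 ^ n)%N -> (2 * a + b <= 3 ^ n)%N.
Proof.
move=> adm uS sumS szS; have m0 : (0 < m)%N by case/andP: adm.
have [|[L mL]] := vanishing_sum_size adm uS sumS; rewrite szS // => sumL.
have prL q : q \in L -> [/\ prime q, q = a \/ (b <= q)%N & odd q].
  move/(allP mL); rewrite /= mem_primes => /and3P[q_pr _ q_m].
  have q_ab := admissible_prime adm q_pr q_m; split=> //.
  by apply: (prime_gt2_odd q_pr); clear -a_ge5 b_gea q_ab; lia.
have no3 q : prime q -> (q %| 3 ^ n)%N -> (q <= 3)%N.
  by move=> q_pr; rewrite Euclid_dvdX // => /andP[/dvdn_leq -> //].
have n3 : (0 < 3 ^ n)%N by rewrite expn_gt0.
(* If all terms of [L] were [a], the prime [a >= 5] would divide [3 ^ n]. *)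
have [y yL b_y] : exists2 y, y \in L & (b <= y)%N.
  have [/hasP //|/hasPn noL] := boolP (has (leq b) L).
  have La q : q \in L -> q = a.
    by move=> qL; have [_ [//|b_q] _] := prL q qL; have := noL q qL; rewrite b_q.
  have DL : L = nseq (size L) a by apply/all_pred1P/allP => q /La /eqP.
  case DL' : L => [|q L'] in sumL; first by rewrite -sumL in n3.
  have qL : q \in L by rewrite DL' mem_head.
  have [q_pr _ _] := prL q qL; have := no3 q q_pr; rewrite (La q qL).
  by rewrite -sumL -DL' DL sumn_nseq dvdn_mulr // => /(_ isT); lia.
have p_rem := perm_to_rem yL.
have sumL' : (y + sumn (rem y L) = 3 ^ n)%N by rewrite -sumL (perm_sumn p_rem).
have odd3 : odd (3 ^ n) by rewrite oddX orbT.
have [y_pr _ y_odd] := prL y yL.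
have prL' q : q \in rem y L -> (a <= q)%N /\ odd q.
  by move/mem_rem => /prL[_ ? ?]; split; lia.
(* The term [y] alone would be a prime dividing [3 ^ n], and two odd terms have an even sum; so two
   further terms, each at least [a], accompany [y >= b]. *)
case: (rem y L) sumL' prL' => [|x [|x' L']] /= sumL' prL'.
- by have := no3 y y_pr; rewrite -sumL' addn0 dvdnn => /(_ isT); lia.
- have [_ x_odd] := prL' x (mem_head _ _).
  by move: odd3; rewrite -sumL' addn0 oddD y_odd x_odd.
have [x_a _] := prL' x (mem_head _ _).
have [|x'_a _] := prL' x'; first by rewrite !inE eqxx orbT.
lia.
Qed.

End Bounds.

(** * Characters and generalized bent functions *)

(** The regular character contains each irreducible character as often as its degree, which is [1]
    for an abelian group. *)
Lemma sum_irr_zmod (G : finZmodType) (x : G) :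
  \sum_(i : Iirr [set: G]) 'chi_i x = #|G|%:R *+ (x == 0).
Proof.
rewrite -FinRing.zmod1gE -(cardsT G) -(cfRegE [set: G]%G) cfReg_sum sum_cfunE.
apply: eq_bigr => i _; rewrite cfunE lin_char1 ?mul1r //.
exact: (char_abelianP _ (FinRing.zmod_abelian _)).
Qed.

(** The sum over all characters of ['chi_i d] times the squared modulus of the transform is computed
    twice: bentness makes the modulus constant, giving [0]; expansion gives [#|G|] times the
    autocorrelation. *)
Lemma bent_autocorrelation (G : finZmodType) m zeta (f : G -> 'Z_m) (d : G) :
  generalized_bent zeta f -> d != 0 ->
  \sum_(x : G) zeta ^+ f x * (zeta ^+ f (x + d))^* = 0.
Proof.
move=> bent d0; pose c x := zeta ^+ f x.
have G0 : #|G|%:R != 0 :> algC.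
  by rewrite pnatr_eq0 -lt0n; apply/card_gt0P; exists 0.
apply: (mulfI G0); rewrite mulr0.
transitivity (\sum_(i : Iirr [set: G])
    'chi_i d * `|\sum_(x : G) c x * 'chi_i x| ^+ 2); last first.
  under eq_bigr => i _ do rewrite bent ?(char_abelianP _ (FinRing.zmod_abelian _)) //.
  by rewrite -big_distrl /= sum_irr_zmod (negPf d0) mulr0n mul0r.
(* By orthogonality only the terms with [y = x + d] survive. *)
transitivity (\sum_(x : G) \sum_(y : G) c x * (c y)^* *
    \sum_(i : Iirr [set: G]) 'chi_i (x - y + d)).
  rewrite big_distrr /=; apply: eq_bigr => x _.
  under [RHS]eq_bigr => y _ do rewrite sum_irr_zmod addrAC subr_eq0.
  rewrite (bigD1 (x + d)) //= big1 => [|y /negPf yx]; last first.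
    by rewrite eq_sym yx mulr0n mulr0.
  by rewrite eqxx mulr1n addr0 mulrC.
under eq_bigr => x _ do under eq_bigr => y _ do rewrite big_distrr /=.
under eq_bigr => x _ do rewrite exchange_big /=.
rewrite exchange_big /=; apply: eq_bigr => i _.
have lin_i : 'chi[[set: G]]_i \is a linear_char.
  exact: (char_abelianP _ (FinRing.zmod_abelian _)).
rewrite normCK rmorph_sum big_distrlr /= big_distrr /=; apply: eq_bigr => x _.
rewrite big_distrr /=; apply: eq_bigr => y _.
have -> : 'chi_i (x - y + d) = 'chi_i x * ('chi_i y)^* * 'chi_i d.
  rewrite -lin_charV_conj ?inE // -!lin_charM ?inE //.
by rewrite rmorphM /= [RHS]mulrC [in RHS]mulrACA !mulrA.
Qed.

Lemma bent_bound n m a b zeta (f : 'rV['Z_3]_n -> 'Z_m) :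
  (0 < n)%N -> (5 <= a)%N -> (a + 2 <= b)%N -> admissible a b m ->
  m.-primitive_root zeta -> generalized_bent zeta f -> (2 * a + b <= 3 ^ n)%N.
Proof.
move=> n0 a5 ab adm zeta_prim bent.
(* Any nonzero shift would do; this one is nonzero because [0 < n]. *)
pose d : 'rV['Z_3]_n := const_mx 1.
have d0 : d != 0.
  apply/eqP => /matrixP /(_ ord0 (Ordinal n0)) /eqP.
  by rewrite !mxE oner_eq0.
pose c x := zeta ^+ f x * (zeta ^+ f (x + d))^*.
apply: (@vanishing_sum_size3 a b a5 ab m (map c (enum 'rV['Z_3]_n))) => //.
- apply/allP => _ /mapP[x _ ->]; apply/unity_rootP.
  rewrite /c exprMn -rmorphXn /= -!exprM !(mulnC _ m) !exprM.
  by rewrite (prim_expr_order zeta_prim) !expr1n rmorph1 mulr1.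
- by rewrite big_map big_enum /=; apply: bent_autocorrelation.
by rewrite size_map -cardE card_mx card_ord mul1n.
Qed.

End VanishingSums.

Theorem theorem3p1 (n t m : nat) (p alpha : nat -> nat) (zeta : algC)
  (n_gt0 : 0 < n) (t_gt0 : 0 < t)
  (p_prime : forall j, 1 <= j <= t -> prime (p j))
  (p_ge5 : 5 <= p 1)
  (p_incr : forall i j, 1 <= i -> i < j -> j <= t -> p i < p j)
  (alpha_gt0 : forall j, 1 <= j <= t -> 0 < alpha j)
  (m_def : m = \prod_(1 <= j < t.+1) p j ^ alpha j)
  (zeta_prim : m.-primitive_root%R zeta)
  (f_exists : exists f : 'rV['Z_3]_n -> 'Z_m, generalized_bent zeta f) :
  2 <= t /\ 2 * p 1 + p 2 <= 3 ^ n.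
Proof.
have [f bent] := f_exists.
have m_gt0 : 0 < m.
  by case: (posnP m) zeta_prim => [->|//] /prim_order_gt0.
have divisors_m q : prime q -> q %| m -> exists2 j, 1 <= j <= t & q = p j.
  move=> q_pr; rewrite m_def big_seq_cond.
  elim/big_rec: _ => [|j x]; first by rewrite dvdn1 => /eqP q1; rewrite q1 in q_pr.
  rewrite andbT mem_index_iota ltnS => j_t IH.
  rewrite Euclid_dvdM // Euclid_dvdX // => /orP[/andP[q_p _]|/IH //].
  by exists j => //; apply/eqP; rewrite -dvdn_prime2 ?p_prime.
(* Keeping [b] free, as any lower bound for the primes after [p 1], treats [t = 1] and [t >= 2]
   together. *)
have bound b : p 1 + 2 <= b -> (forall j, 1 < j <= t -> b <= p j) ->
    2 * p 1 + b <= 3 ^ n.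
  move=> pb le_b; apply: (bent_bound n_gt0 p_ge5 pb _ zeta_prim bent).
  rewrite /admissible m_gt0; apply/allP => q; rewrite mem_primes.
  case/and3P=> q_pr _ /(divisors_m q q_pr)[j j_t ->].
  have [->|j1] := eqVneq j 1; first by rewrite eqxx.
  by rewrite le_b ?orbT //; lia.
have [t1|t2] := leqP t 1.
  (* For [t = 1] the condition on later primes is vacuous, so [b] may be taken above [3 ^ n], which
     is absurd. *)
  have := bound (p 1 + 2 + 3 ^ n); rewrite leq_addr => /(_ isT).
  suff no_j : forall j, 1 < j <= t -> p 1 + 2 + 3 ^ n <= p j.
    by move/(_ no_j); clear; lia.
  by move=> j j_t; exfalso; clear -j_t t1; lia.
split=> //; apply: bound.
  apply: prime_gap; rewrite ?p_prime ?p_incr ?t_gt0 //.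
  exact: leq_trans p_ge5.
move=> j /andP[]; rewrite leq_eqVlt => /predU1P[<- //|j2 j_t].
by apply: ltnW; apply: p_incr.
Qed.
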